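(* Let $k \ge 1$ and $q \ge 2$ be integers. Then $f_1(q,k) = qk$, where $f_1(q,k)$ is the minimum $n$ such that there exists a $k$-universal word of length $n$ over an alphabet with $q$ symbols.
   Context: Let $\Sigma = [q] = \{1,\dots,q\}$ be an alphabet with $q$ symbols. A word of length $n$ over $\Sigma$ is a sequence of $n$ symbols of $\Sigma$. A word $w$ contains a word $w'$ if $w'$ can be obtained from $w$ by deleting letters, i.e. $w'$ is a (not necessarily contiguous) subsequence of $w$. A word over $\Sigma$ is $k$-universal if it contains every word over $\Sigma$ of length at most $k$ (equivalently, every word over $\Sigma$ of length exactly $k$). *)

(* Defs.v *)
From mathcomp Require Import all_boot.
Set Implicit Arguments.
Unset Strict Implicit.
Unset Printing Implicit Defensive.

(* The alphabet [q] = {1, ..., q} is represented by 'I_q = {0, ..., q - 1}.  A *)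
(* word w contains a word u when subseq u w, i.e. u arises from w by deleting  *)
(* letters, which need not leave a contiguous factor.                          *)

Definition universal (q k : nat) (w : seq 'I_q) : bool :=
  [forall m : 'I_k.+1, [forall u : m.-tuple 'I_q, subseq u w]].

Lemma universalP (q k : nat) (w : seq 'I_q) :
  reflect (forall u : seq 'I_q, size u <= k -> subseq u w) (universal k w).
Proof.
apply: (iffP forallP) => [univ_w u le_u_k | univ_w m].
  exact: (forallP (univ_w (Ordinal (le_u_k : size u < k.+1))) (in_tuple u)).
by apply/forallP => u; apply: univ_w; rewrite size_tuple -ltnS.
Qed.

Definition has_universal_word (q k n : nat) : bool :=
  [exists w : n.-tuple 'I_q, universal k w].

(* Only needed for the minimum below to exist: the concatenation of all the    *)
(* words of length at most k is k-universal.                                   *)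
Lemma ex_universal_word (q k : nat) : exists n, has_universal_word q k n.
Proof.
pose ws := [seq tval u | m : 'I_k.+1 <- enum 'I_k.+1,
  u : m.-tuple 'I_q <- enum {: m.-tuple 'I_q}].
exists (size (flatten ws)); apply/existsP; exists (in_tuple (flatten ws)).
apply/universalP => u le_u_k /=.
have : u \in ws.
  apply/allpairsPdep; exists (Ordinal (le_u_k : size u < k.+1)), (in_tuple u).
  by rewrite !mem_enum.
elim: ws => //= v ws IHws; rewrite inE => /predU1P[<-|/IHws sub_u].
  exact: prefix_subseq.
exact: subseq_trans sub_u (suffix_subseq _ _).
Qed.

Definition f1 (q k : nat) : nat := ex_minn (ex_universal_word q k).

(* Main.v *)
Require Import Defs.
From mathcomp Require Import all_boot.

(** The alphabet written [k] times in a row is [k]-universal, since the [i]-th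
    letter of a word can be picked from the [i]-th copy; so [q * k] letters
    suffice ([subseq_flatten_nseq_enum]).

    Conversely, an adversary spells out a word that uses up at least [q] letters
    of [w] for each of its own letters.  The first [q - 1] letters of [w] miss
    some letter [a], so any embedding into [w] of a word [a :: u] has to send
    [u] strictly beyond the first [q] letters.  Hence deleting the first [q]
    letters of a [k.+1]-universal word leaves a [k]-universal one, and
    [q * k <= size w] follows by induction on [k] ([leq_size_universal]). *)

Lemma subseq_cons_cat_notin (T : eqType) (a : T) (u p s : seq T) :
  a \notin p -> subseq (a :: u) (p ++ s) -> subseq (a :: u) s.
Proof.
elim: p => //= b p IHp; rewrite inE negb_or => /andP[/negbTE neq_ab a_p].
by rewrite eq_sym in neq_ab; rewrite eq_sym neq_ab => /(IHp a_p).
Qed.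

Lemma subseq_behead (T : eqType) (a : T) (u s : seq T) :
  subseq (a :: u) s -> subseq u (behead s).
Proof.
by case: s => //= b s; case: eqP => // _; apply: subseq_trans; apply: subseq_cons.
Qed.

Lemma exists_notin_short (T : finType) (p : seq T) :
  size p < #|T| -> exists a, a \notin p.
Proof.
move=> lt_p; apply/existsP; rewrite -negb_forall; apply: contraL lt_p.
move=> /forallP all_p; rewrite -leqNgt; apply: leq_trans (card_size p).
by apply/subset_leq_card/subsetP => a _; apply: all_p.
Qed.

(** Any letter missing among the first [#|T| - 1] letters of [w] works.  The
    choice depends on [w] alone, not on [u]: this is what lets a bound on all
    words [a :: u] pass to all words [u]. *)
Lemma exists_costly_letter (T : finType) (w : seq T) :
  0 < #|T| ->
  exists a, forall u, subseq (a :: u) w ->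
    #|T| <= size w /\ subseq u (drop #|T| w).
Proof.
move=> T_gt0.
have /exists_notin_short[a a_p] : size (take #|T|.-1 w) < #|T|.
  rewrite size_take_min; apply: leq_ltn_trans (geq_minl _ _) _.
  by rewrite ltn_predL.
exists a => u; rewrite -{1}(cat_take_drop #|T|.-1 w).
move=> /(subseq_cons_cat_notin _ _ _ _ _ a_p) sub_au; split.
  have := size_subseq sub_au.
  by rewrite size_drop /= => /(leq_ltn_trans (leq0n _)); rewrite subn_gt0 prednK.
by have := subseq_behead _ _ _ _ sub_au; rewrite -drop1 drop_drop add1n prednK.
Qed.

Lemma leq_size_universal (T : finType) (k : nat) (w : seq T) :
  (forall u : seq T, size u = k -> subseq u w) -> #|T| * k <= size w.
Proof.
have [T0 | T_gt0] := posnP #|T|; first by rewrite T0.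
elim: k w => [|k IHk] w univ_w; first by rewrite muln0.
have [a costly_a] := exists_costly_letter T w T_gt0.
have [le_w _] : #|T| <= size w /\ subseq (nseq k a) (drop #|T| w).
  by apply: costly_a; apply: univ_w; rewrite /= size_nseq.
rewrite mulnS -(subnKC le_w) leq_add2l -size_drop; apply: IHk => u size_u.
by have [|_] := costly_a u; first by apply: univ_w; rewrite /= size_u.
Qed.

Lemma subseq_flatten_nseq_enum (T : finType) (k : nat) (u : seq T) :
  size u <= k -> subseq u (flatten (nseq k (enum T))).
Proof.
elim: u k => [|a u IHu] [|k] //= le_u_k; first exact: sub0seq.
rewrite -cat1s; apply: cat_subseq (IHu k le_u_k).
by rewrite sub1seq mem_enum.
Qed.

Theorem theorem1 (q k : nat) (hk : 1 <= k) (hq : 2 <= q) : f1 q k = q * k.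
Proof.
rewrite /f1; case: ex_minnP => n /existsP[w /universalP univ_w] min_n.
apply/eqP; rewrite eqn_leq; apply/andP; split; last first.
  rewrite -[q in q * k]card_ord -(size_tuple w).
  by apply: leq_size_universal => u size_u; apply: univ_w; rewrite size_u.
apply: min_n; apply/existsP.
have size_w : size (flatten (nseq k (enum 'I_q))) == q * k.
  by rewrite size_flatten /shape map_nseq sumn_nseq size_enum_ord.
by exists (Tuple size_w); apply/universalP; apply: subseq_flatten_nseq_enum.
Qed.
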